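(* Let $f\in\mathbb{R}[X]$ be a polynomial of odd degree $d\geq 3$ with positive leading coefficient. Then $\mathrm{J}(f)\subseteq\mathbb{R}$ if and only if $\mathrm{Fix}(f,\mathbb{R})\subseteq\mathrm{I}(f)$.
   Context: $\mathrm{J}(f)\subseteq\mathbb{P}^1(\mathbb{C})$ is the Julia set of $f$, i.e. the complement of the maximal open subset of $\mathbb{P}^1(\mathbb{C})$ on which the family of iterates of $f$ is equicontinuous. $\mathrm{Fix}(f,\mathbb{R})=\{x\in\mathbb{R}: f(x)=x\}$. For $f\in\mathbb{R}[X]$ of degree $d\ge2$, the critical interval $\mathrm{I}(f)$ is the set of all $t\in\mathbb{R}$ such that $f(X)=t$ has $d$ real solutions counted with multiplicity. *)

(* Defs.v *)
From HB Require Import structures.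
From mathcomp Require Import all_boot all_order all_algebra.
From mathcomp Require Import polyrcf complex.
From mathcomp Require Import all_classical all_reals all_analysis.
From mathcomp Require Import ring.

Set Implicit Arguments.
Unset Strict Implicit.
Unset Printing Implicit Defensive.

Import Order.TTheory GRing.Theory Num.Theory.
Import numFieldNormedType.Exports.
Import Normc.

Local Open Scope classical_set_scope.
Local Open Scope ring_scope.
Local Open Scope complex_scope.

(* P^1(C) as the Riemann sphere: [Some z] is the point [z : 1] of the affine  *)
(* chart C = R[i], and [None] is the point at infinity [1 : 0].               *)
Definition P1C (R : realType) : Type := option R[i].

HB.instance Definition _ (R : realType) := Pointed.on (P1C R).

Section chordal_metric.
Context {R : realType}.
Local Notation C := R[i].
Implicit Types (z w : C) (p q r : P1C R).

Definition sqnormc z : R := complex.Re z ^+ 2 + complex.Im z ^+ 2.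

Definition hcoord p : C * C := if p is Some z then (z, 1) else (1, 0).

Definition hnorm (u : C * C) : R := Num.sqrt (sqnormc u.1 + sqnormc u.2).

Definition hdet (u v : C * C) : C := u.1 * v.2 - u.2 * v.1.

Definition chordal p q : R :=
  2 * normc (hdet (hcoord p) (hcoord q))
    / (hnorm (hcoord p) * hnorm (hcoord q)).

Lemma normcE_sqrt z : normc z = Num.sqrt (sqnormc z).
Proof. by case: z. Qed.

Lemma sqnormc_ge0 z : 0 <= sqnormc z.
Proof. by rewrite addr_ge0 ?sqr_ge0. Qed.

Lemma hnorm_gt0 p : 0 < hnorm (hcoord p).
Proof.
rewrite sqrtr_gt0; case: p => [z|] /=.
  by rewrite ltr_wpDl ?sqnormc_ge0// /sqnormc /= expr1n expr0n addr0.
by rewrite /sqnormc /= !expr0n expr1n !addr0.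
Qed.

Lemma chordal_Some z w :
  chordal (Some z) (Some w) =
  2 * normc (z - w) / (Num.sqrt (1 + normc z ^+ 2) * Num.sqrt (1 + normc w ^+ 2)).
Proof.
rewrite /chordal /hdet /hnorm /= mulr1 mul1r !normcE_sqrt.
rewrite !sqr_sqrtr ?sqnormc_ge0// ![1 + _]addrC.
by congr (_ / (Num.sqrt (_ + _) * Num.sqrt (_ + _)));
  rewrite /sqnormc /= expr1n expr0n addr0.
Qed.

Lemma chordal_infty z : chordal (Some z) None = 2 / Num.sqrt (1 + normc z ^+ 2).
Proof.
rewrite /chordal /hdet /hnorm /= mulr0 mulr1 sub0r normcN normc1 mulr1.
rewrite normcE_sqrt sqr_sqrtr ?sqnormc_ge0// [1 + _]addrC.
by rewrite /sqnormc /= !expr1n !expr0n !addr0 sqrtr1 mulr1.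
Qed.

Lemma chordalxx p : chordal p p = 0.
Proof. by rewrite /chordal /hdet [X in X - _]mulrC subrr normc0 mulr0 mul0r. Qed.

Lemma chordal_positivity p q : chordal p q = 0 -> p = q.
Proof.
move=> /eqP; rewrite /chordal mulf_eq0 invr_eq0 !mulf_eq0.
rewrite !(gt_eqF (hnorm_gt0 _)) pnatr_eq0 !orbF /= => /eqP/eq0_normc.
case: p q => [z|] [w|] //=; rewrite /hdet /=.
- by rewrite mulr1 mul1r => /eqP; rewrite subr_eq0 => /eqP ->.
- by rewrite mulr0 mulr1 sub0r => /eqP; rewrite oppr_eq0 oner_eq0.
- by rewrite mul0r mulr1 subr0 => /eqP; rewrite oner_eq0.
Qed.

Lemma chordal_sym p q : chordal p q = chordal q p.
Proof.
rewrite /chordal [X in _ / X]mulrC; congr (2 * _ / _).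
by rewrite -normcN /hdet opprB [X in X - _]mulrC [X in _ - X]mulrC.
Qed.

Definition hdot (u v : C * C) : C := u.1 * v.1^* + u.2 * v.2^*.

Lemma normc_hdot u v : normc (hdot u v) <= hnorm u * hnorm v.
Proof.
have nn (x : C * C) : 0 <= sqnormc x.1 + sqnormc x.2 by rewrite addr_ge0 ?sqnormc_ge0.
rewrite /hnorm -sqrtrM// normcE_sqrt ler_wsqrtr//.
suff -> : (sqnormc u.1 + sqnormc u.2) * (sqnormc v.1 + sqnormc v.2) =
    sqnormc (hdot u v) + sqnormc (hdet u v) by rewrite lerDl sqnormc_ge0.
case: u v => -[a b] [c d] [[e f] [g h]]; rewrite /sqnormc /hdot /hdet /=; ring.
Qed.

Lemma normc_hdet_triangle (u v w : C * C) :
  normc (hdet u w) * hnorm v ^+ 2 <=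
  (normc (hdet u v) * hnorm w + normc (hdet v w) * hnorm u) * hnorm v.
Proof.
have nn (x : C * C) : 0 <= sqnormc x.1 + sqnormc x.2 by rewrite addr_ge0 ?sqnormc_ge0.
have -> : hnorm v ^+ 2 = normc (hdot v v).
  rewrite sqr_sqrtr//.
  have -> : hdot v v = (sqnormc v.1 + sqnormc v.2)%:C.
    case: v => -[a b] [c d]; rewrite /hdot /sqnormc /=.
    by apply/eqP; rewrite eq_complex /=; apply/andP; split; apply/eqP; ring.
  by rewrite /normc /= expr0n /= addr0 sqrtr_sqr ger0_norm.
rewrite -normcM.
have -> : hdet u w * hdot v v = hdet u v * hdot w v + hdet v w * hdot u v.
  by rewrite /hdet /hdot; ring.
apply: (le_trans (le_normcD _ _)); rewrite !normcM mulrDl.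
have normc_ge0 z : 0 <= normc z by rewrite normcE_sqrt sqrtr_ge0.
by rewrite -!mulrA lerD// ler_wpM2l// normc_hdot.
Qed.

Lemma chordal_triangle q p r : chordal p r <= chordal p q + chordal q r.
Proof.
have := normc_hdet_triangle (hcoord p) (hcoord q) (hcoord r).
rewrite expr2 mulrA ler_pM2r ?hnorm_gt0// /chordal.
have := hnorm_gt0 p; have := hnorm_gt0 q; have := hnorm_gt0 r.
set a := hnorm (hcoord p); set b := hnorm (hcoord q); set c := hnorm (hcoord r).
set x := normc (hdet (hcoord p) (hcoord r)).
set y := normc (hdet (hcoord p) (hcoord q)).
set z := normc (hdet (hcoord q) (hcoord r)) => c0 b0 a0 xyz.
rewrite -subr_ge0.
have -> : 2 * y / (a * b) + 2 * z / (b * c) - 2 * x / (a * c) =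
    2 * (y * c + z * a - x * b) / (a * b * c).
  by field; rewrite !gt_eqF.
apply: divr_ge0; last by rewrite ltW// !mulr_gt0.
by apply: mulr_ge0; rewrite ?subr_ge0.
Qed.

End chordal_metric.

HB.instance Definition _ (R : realType) :=
  @isMetric.Build R (P1C R) chordal chordalxx chordal_positivity chordal_sym
    chordal_triangle.

Lemma ball_chordalE (R : realType) (p : P1C R) e : ball p e = [set q | chordal p q < e].
Proof. by []. Qed.

Section dynamics.
Context {R : realType}.

(* The self-map of P^1(C) induced by a nonconstant polynomial; it fixes       *)
(* infinity, which would be wrong for constants.                              *)
Definition P1map (g : {poly R[i]}) (p : P1C R) : P1C R :=
  if p is Some z then Some g.[z] else None.

(* [equicontinuous] constrains only the points of U here: the points outside  *)
(* U are isolated in [subspace U].                                            *)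
Definition equicontinuous_iterates (g : {poly R[i]}) (U : set (P1C R)) : Prop :=
  @equicontinuous (subspace U) (P1C R) nat setT (fun n => iter n (P1map g)).

Lemma equicontinuous_iteratesP g (U : set (P1C R)) :
  equicontinuous_iterates g U <->
  forall x : P1C R, U x -> forall E : set (P1C R * P1C R), entourage E ->
    \forall y \near x, U y ->
      forall n, E (iter n (P1map g) x, iter n (P1map g) y).
Proof.
split=> [eU x Ux E entE|eU x E entE].
  have : @nbhs_subspace (P1C R) U x [set y | forall n, setT n ->
      E (iter n (P1map g) x, iter n (P1map g) y)] by exact: eU.
  rewrite -nbhs_subspace_in//; rewrite /within /=.
  by apply: filterS => y + Uy n; exact.
change (@nbhs_subspace (P1C R) U x [set y | forall n, setT n ->
      E (iter n (P1map g) x, iter n (P1map g) y)]).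
have [Ux|Ux] := pselect (U x).
  rewrite -nbhs_subspace_in//; have := eU _ Ux _ entE; rewrite /within /=.
  by apply: filterS => y + Uy n _; exact.
by rewrite -nbhs_subspace_out// => y -> n _; exact: entourage_refl.
Qed.

Definition fatou_set (g : {poly R[i]}) : set (P1C R) :=
  \bigcup_(U in [set U | open U /\ equicontinuous_iterates g U]) U.

Definition julia_set (g : {poly R[i]}) : set (P1C R) := ~` fatou_set g.

Lemma open_fatou_set g : open (fatou_set g).
Proof. by apply: bigcup_open => U []. Qed.

Lemma equicontinuous_fatou_set g : equicontinuous_iterates g (fatou_set g).
Proof.
apply/equicontinuous_iteratesP => x [U [oU /equicontinuous_iteratesP eU] Ux] E.
move=> /(eU _ Ux); have nU : nbhs x U by exact: open_nbhs_nbhs.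
by move: nU; apply: filterS2 => y Uy + _; exact.
Qed.

Lemma fatou_set_max g U :
  open U -> equicontinuous_iterates g U -> U `<=` fatou_set g.
Proof. by move=> oU eU x Ux; exists U. Qed.

Definition real_line : set (P1C R) := [set Some x%:C | x in [set: R]].

Definition fix_real (f : {poly R}) : set R := [set x | f.[x] = x].

(* [rootsR q] lists the real roots of q without repetition and [mup x q] is   *)
(* the multiplicity of x as a root of q, so the sum counts the real solutions *)
(* of f(X) = t with multiplicity.                                             *)
Definition critical_interval (f : {poly R}) : set R :=
  [set t | (\sum_(x <- rootsR (f - t%:P)) mup x (f - t%:P) = (size f).-1)%N].

End dynamics.

Arguments real_line : clear implicits.

(* Main.v *)
(* If all roots of a polynomial p lie in a real segment K and s is the
   projection of z on K, then |s - r|^2 + dist(z, K)^2 <= |z - r|^2 for every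
   root r, so that |p(z)| exceeds |p(s)| by a factor exponential in deg p.
   <=: let a < b be the extreme real fixed points and K = [a, b]; the equations
   f = a and f = b have all their roots in K.  Since |t - a| + |t - b| = b - a
   for t in K, the comparison of f(z) with f(s) yields f^-1(K) `<=` K.  Hence
   f^n - a and f^n - b also have their d^n roots in K, and comparing f^n(z) with
   the real number f^n(s) shows that f^n(z) tends to infinity uniformly at
   positive distance from K, so the complement of K is in the Fatou set.
   =>: if f(z) = x = f(x) with z not real, then the vertical ray from z away
   from the real line lies in the Fatou set, where escaping to infinity is a
   locally constant property; far points escape whereas z does not. *)

Require Import Defs.
From mathcomp Require Import all_boot all_order all_algebra.
From mathcomp Require Import polyrcf complex.
From mathcomp Require Import all_classical all_reals all_analysis.
From mathcomp Require Import ring lra.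

Import Order.TTheory GRing.Theory Num.Theory.
Local Open Scope classical_set_scope.
Local Open Scope ring_scope.

Section JuliaSet.
Context {R : realType}.
Local Open Scope complex_scope.
Import Normc.
Local Notation C := R[i].
Local Notation toC := (map_poly (real_complex R)).

(** * Moduli of polynomial values in terms of the complex roots *)

Lemma normc_ge0 (z : C) : 0 <= normc z.
Proof. by rewrite normcE_sqrt sqrtr_ge0. Qed.

Lemma normc_sqr (z : C) : normc z ^+ 2 = complex.Re z ^+ 2 + complex.Im z ^+ 2.
Proof. by rewrite normcE_sqrt sqr_sqrtr ?sqnormc_ge0. Qed.

Lemma normc_real (x : R) : normc x%:C = `|x|.
Proof. by rewrite /normc /= expr0n /= addr0 sqrtr_sqr. Qed.

Lemma normc_prod (I : Type) (s : seq I) (F : I -> C) :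
  normc (\prod_(i <- s) F i) = \prod_(i <- s) normc (F i).
Proof. by elim/big_rec2: _ => [|i y z _ <-]; rewrite ?normc1 ?normcM. Qed.

Lemma ler_normc_sub (z w : C) : normc z - normc w <= normc (z - w).
Proof. by rewrite lerBlDr; apply: le_trans (le_normcD _ _); rewrite subrK. Qed.

Lemma normc_distC (z w : C) : normc (z - w) = normc (w - z).
Proof. by rewrite -normcN opprB. Qed.

Lemma real_complexP (z : C) : complex.Im z = 0 -> z = (complex.Re z)%:C.
Proof. by case: z => x y /= ->. Qed.

Lemma real_complex_inj (x y : R) : x%:C = y%:C -> x = y.
Proof. by case. Qed.

Lemma normc_horner_roots (p : {poly C}) : exists rs : seq C,
  [/\ size rs = (size p).-1,
      p != 0 -> forall r, r \in rs -> root p r &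
      forall z, normc p.[z] = normc (lead_coef p) * \prod_(r <- rs) normc (z - r)].
Proof.
have [->|p0] := eqVneq p 0.
  exists [::]; rewrite size_poly0 lead_coef0; split=> // z.
  by rewrite horner0 normc0 mul0r.
have [rs Dp] := closed_field_poly_normal p; exists rs.
have lc0 : lead_coef p != 0 by rewrite lead_coef_eq0.
split=> [|_ r rrs|z].
- by rewrite Dp size_scale // size_prod_XsubC.
- by rewrite Dp rootZ // root_prod_XsubC.
- rewrite {1}Dp hornerZ normcM horner_prod normc_prod; congr (_ * _).
  by apply: eq_bigr => r _; rewrite hornerXsubC.
Qed.

(** Both values are the same leading coefficient times a product over the roots, and the hypothesis
    compares these products factor by factor, gaining [q] once per root. *)
Lemma normc_horner_scale (p : {poly C}) (q : R) (s z : C) : p != 0 -> 0 <= q ->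
  (forall r, root p r -> q * normc (s - r) <= normc (z - r)) ->
  q ^+ (size p).-1 * normc p.[s] <= normc p.[z].
Proof.
move=> p0 q0 qr; have [rs [<- /(_ p0) rrs pE]] := normc_horner_roots p.
rewrite !pE mulrCA ler_wpM2l ?normc_ge0 //.
elim: rs rrs {pE} => [|r rs IH] rrs; first by rewrite !big_nil mulr1.
rewrite !big_cons /= exprS mulrACA ler_pM ?mulr_ge0 ?normc_ge0 ?exprn_ge0 //.
- by apply: prodr_ge0 => ? _; exact: normc_ge0.
- by apply/qr/rrs; rewrite mem_head.
- by apply: IH => t ts; apply: rrs; rewrite inE ts orbT.
Qed.

(** * Counting real roots, and the critical interval *)

Lemma rootsR_factor (p : {poly R}) : p != 0 -> exists q : {poly R},
  (forall x, ~~ root q x) /\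
  p = q * \prod_(x <- rootsR p) ('X - x%:P) ^+ mup x p.
Proof.
move=> p0; have rE := roots_on_rootsR p0.
have /dvdpP[q Dp] : \prod_(x <- rootsR p) ('X - x%:P) ^+ mup x p %| p.
  have : uniq (rootsR p) by exact: uniq_roots.
  elim: (rootsR p) => [|x s IH] /=; first by rewrite big_nil dvd1p.
  case/andP=> xs us; rewrite big_cons Gauss_dvdp.
    by rewrite -mup_geq // leqnn IH.
  apply: coprimep_expl; rewrite coprimep_sym coprimep_XsubC /root horner_prod.
  rewrite prodf_seq_neq0; apply/allP => y ys /=.
  rewrite horner_exp hornerXsubC expf_neq0 // subr_eq0.
  by apply: contraNneq xs => ->.
exists q; split=> // x; apply/negP => qx.
have xp : x \in rootsR p.
  by rewrite -rE in_itv /= Dp rootM qx.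
(* A real root of the cofactor would raise the multiplicity of [x] in [p] above [mup x p]. *)
have : ('X - x%:P) ^+ (mup x p).+1 %| p.
  rewrite [X in _ %| X]Dp (big_rem x) //= exprS mulrA dvdp_mulr //.
  by rewrite dvdp_mul // dvdp_XsubCl.
by rewrite -mup_geq // ltnn.
Qed.

Lemma size_prod_XsubC_exp (s : seq R) (m : R -> nat) :
  size (\prod_(x <- s) ('X - x%:P) ^+ m x) = (\sum_(x <- s) m x).+1.
Proof.
elim: s => [|x s IH]; first by rewrite !big_nil size_poly1.
rewrite !big_cons size_monicM ?monic_exp ?monicXsubC ?size_exp_XsubC //.
  by rewrite IH addnS.
by rewrite -size_poly_eq0 IH.
Qed.

(** Split off the real roots of [f - t]. The degree of the cofactor [q] is the number of solutions
    that the count misses, so [t] is in the critical interval exactly when [q] is constant. A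
    nonconstant [q] has a complex root, and this root cannot be real. *)
Lemma critical_intervalP (f : {poly R}) (t : R) : (1 < size f)%N ->
  critical_interval f t <-> forall z, (toC f).[z] = t%:C -> complex.Im z = 0.
Proof.
move=> sf; set p := f - t%:P.
have sp : size p = size f.
  by rewrite size_polyDl // size_polyN (leq_ltn_trans (size_polyC_leq1 t)).
have p0 : p != 0 by rewrite -size_poly_eq0 sp -lt0n ltnW.
have pE z : ((toC f).[z] = t%:C) <-> root (toC p) z.
  rewrite rmorphB /= map_polyC rootE !hornerE /= subr_eq0.
  by split=> /eqP.
have [q [qN Dp]] := rootsR_factor p p0.
have q0 : q != 0 by apply: contra_neq p0 => q0; rewrite Dp q0 mul0r.
have P0 : \prod_(x <- rootsR p) ('X - x%:P) ^+ mup x p != 0.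
  by apply: contra_neq p0 => P0; rewrite Dp P0 mulr0.
have szE : (size p).-1 = ((size q).-1 + \sum_(x <- rootsR p) mup x p)%N.
  rewrite {1}Dp size_mul // size_prod_XsubC_exp addnS /=.
  by rewrite -subn1 -addnBAC ?subn1 // size_poly_gt0.
have -> : critical_interval f t <-> size q = 1.
  rewrite /critical_interval /= -/p -sp szE; split=> [/eqP|->]; last by rewrite add0n.
  rewrite -[X in X == _]add0n eqn_add2r => /eqP sq.
  by rewrite -(prednK (_ : 0 < size q)%N) ?size_poly_gt0 // -sq.
split=> [sq z /pE|H].
  have /size_poly1P[c c0 qc] : size q == 1 by rewrite sq.
  rewrite Dp qc rmorphM rootM /= map_polyC /= rootC fmorph_eq0 (negPf c0) /=.
  rewrite rmorph_prod /root horner_prod prodf_seq_eq0 => /hasP[x _ /=].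
  rewrite rmorphXn /= horner_exp expf_eq0 => /andP[_].
  by rewrite map_polyXsubC hornerXsubC subr_eq0 => /eqP ->.
apply/eqP; apply/negPn/negP => sq.
have /closed_rootP[z qz] : size (toC q) != 1 by rewrite size_map_poly.
have /H zr : (toC f).[z] = t%:C by apply/pE; rewrite Dp rmorphM rootM qz.
have := qN (complex.Re z); rewrite /root -(inj_eq real_complex_inj).
move: qz; rewrite (real_complexP z zr) /root /=.
by rewrite (horner_map (real_complex R)) => ->.
Qed.

(** * Distance to a real segment, and growth of polynomials with all roots in it *)

Definition clamp (a b x : R) : R := Num.max a (Num.min b x).

Definition seg_dist (a b : R) (z : C) : R :=
  normc (z - (clamp a b (complex.Re z))%:C).

Lemma clamp_itv (a b x : R) : a <= b -> a <= clamp a b x <= b.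
Proof. by move=> ab; rewrite /clamp le_max lexx /= ge_max ab ge_min lexx. Qed.

Lemma seg_dist_ge0 (a b : R) (z : C) : 0 <= seg_dist a b z.
Proof. exact: normc_ge0. Qed.

(* The angle at the projection [clamp a b (Re z)] of [z] is at least a right one. *)
Lemma seg_dist_obtuse (a b r : R) (z : C) : a <= r <= b ->
  (clamp a b (complex.Re z) - r) ^+ 2 + seg_dist a b z ^+ 2
    <= normc (z - r%:C) ^+ 2.
Proof.
rewrite /seg_dist !normc_sqr; case: z => x y /= arb.
rewrite /clamp; have [bx|xb] := leP b x; [have [_|ba] := leP a b|have [_|xa] := leP a x]; nra.
Qed.

Lemma seg_dist_le (a b r : R) (z : C) : a <= r <= b ->
  seg_dist a b z <= normc (z - r%:C).
Proof.
move=> /(@seg_dist_obtuse _ _ _ z) H.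
rewrite -ler_sqr ?nnegrE ?normc_ge0 //; apply: le_trans H.
by rewrite lerDr sqr_ge0.
Qed.

Lemma seg_dist_lip (a b : R) (z w : C) : a <= b ->
  seg_dist a b z <= normc (z - w) + seg_dist a b w.
Proof.
move=> ab; apply: le_trans (seg_dist_le _ _ _ z (clamp_itv a b (complex.Re w) ab)) _.
by rewrite -(subrKA w) /=; exact: le_normcD.
Qed.

Lemma seg_dist_ge (a b : R) (z : C) : a <= b ->
  normc z - (`|a| + `|b|) <= seg_dist a b z.
Proof.
move=> ab; apply: le_trans (ler_normc_sub _ _).
rewrite lerD2l lerN2 normc_real; have := clamp_itv a b (complex.Re z) ab.
have := ler_norm a; have := ler_norm b; have := ler_norm (- a).
have := normr_ge0 a; have := normr_ge0 b; rewrite normrN.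
by move=> *; rewrite ler_norml; lra.
Qed.

Lemma seg_dist_eq0 (a b : R) (z : C) : a <= b -> seg_dist a b z = 0 ->
  exists2 r, a <= r <= b & z = r%:C.
Proof.
move=> ab /eq0_normc /eqP; rewrite subr_eq0 => /eqP zE.
by exists (clamp a b (complex.Re z)); rewrite ?clamp_itv.
Qed.

(** For a root r in [a, b], the projection s of [z] satisfies |s - r| <= b - a. With D the distance
    to the segment, the obtuse angle at s gives |z - r|^2 >= |s - r|^2 + D^2 >= (1 + D^2 / (b -
    a)^2) |s - r|^2, a gain of a fixed factor per root. *)
Lemma normc_horner_seg (a b : R) (p : {poly C}) (z : C) : a < b -> p != 0 ->
  (forall w, root p w -> exists2 r, a <= r <= b & w = r%:C) ->
  (1 + seg_dist a b z ^+ 2 / (b - a) ^+ 2) ^+ (size p).-1 *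
    normc p.[(clamp a b (complex.Re z))%:C] ^+ 2 <= normc p.[z] ^+ 2.
Proof.
move=> ab p0 rp; set s := clamp a b _; set e := 1 + _.
have L0 : 0 < (b - a) ^+ 2 by rewrite exprn_gt0 // subr_gt0.
have e0 : 0 <= e by rewrite addr_ge0 // divr_ge0 ?sqr_ge0 // ltW.
have : Num.sqrt e ^+ (size p).-1 * normc p.[s%:C] <= normc p.[z].
  apply: normc_horner_scale => // _ /rp[r rab ->].
  rewrite -ler_sqr ?nnegrE ?mulr_ge0 ?normc_ge0 ?sqrtr_ge0 //.
  apply: le_trans (seg_dist_obtuse _ _ _ z rab); rewrite -/s.
  rewrite exprMn sqr_sqrtr // -rmorphB normc_real real_normK ?num_real //.
  rewrite mulrDl mul1r lerD2l mulrAC ler_pdivrMr // ler_wpM2l ?sqr_ge0 //.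
  have := clamp_itv a b (complex.Re z) (ltW ab); rewrite -/s => sab.
  nra.
move=> H; rewrite -(sqr_sqrtr e0) exprAC -exprMn ler_sqr ?nnegrE //.
  by rewrite mulr_ge0 ?exprn_ge0 ?sqrtr_ge0 ?normc_ge0.
exact: normc_ge0.
Qed.

(** * Backward invariance of the segment, and escape of the points off it *)

Lemma horner_toC (f : {poly R}) (x : R) : (toC f).[x%:C] = f.[x]%:C.
Proof. exact: (horner_map (real_complex R)). Qed.

Lemma size_subC (S : nzRingType) (p : {poly S}) (c : S) : (1 < size p)%N ->
  size (p - c%:P) = size p.
Proof.
by move=> sp; rewrite size_polyDl // size_polyN (leq_ltn_trans (size_polyC_leq1 c)).
Qed.

(** For [z] off the segment, f(s) would be closer than [t] both to [a] and to [b], although the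
    distances from [t] to them add up to only b - a. *)
Lemma preimage_seg (f : {poly R}) (a b t : R) (z : C) :
  a < b -> (1 < size f)%N -> a <= t <= b ->
  (forall w, (toC f).[w] = a%:C -> exists2 r, a <= r <= b & w = r%:C) ->
  (forall w, (toC f).[w] = b%:C -> exists2 r, a <= r <= b & w = r%:C) ->
  (toC f).[z] = t%:C -> exists2 r, a <= r <= b & z = r%:C.
Proof.
move=> ab sf tab Ha Hb zt; apply: (seg_dist_eq0 _ _ _ (ltW ab)).
apply/eqP; apply/negPn/negP => D0.
have key u : (forall w, (toC f).[w] = u%:C -> exists2 r, a <= r <= b & w = r%:C) ->
    exists2 e, 1 < e & e * (f.[clamp a b (complex.Re z)] - u) ^+ 2 <= (t - u) ^+ 2.
  move=> Hu; have sFu : (1 < size (toC f - u%:C%:P)%R)%N.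
    by rewrite size_subC size_map_poly.
  exists ((1 + seg_dist a b z ^+ 2 / (b - a) ^+ 2) ^+ (size (toC f - u%:C%:P)).-1).
    rewrite exprn_egt1; first by rewrite -subn1 subn_eq0 -ltnNge.
    rewrite ltrDl divr_gt0 // exprn_gt0 ?subr_gt0 //.
    by rewrite lt_neqAle eq_sym D0 seg_dist_ge0.
  have := normc_horner_seg a b (toC f - u%:C%:P) z ab.
  rewrite !(hornerD, hornerN, hornerC) zt horner_toC -!rmorphB !normc_real.
  rewrite !real_normK ?num_real //; apply.
    by rewrite -size_poly_eq0 -lt0n ltnW.
  by move=> w; rewrite rootE !hornerE subr_eq0 => /eqP/Hu.
have [ea ea1 Ka] := key a Ha; have [eb eb1 Kb] := key b Hb.
move: Ka Kb; set y := f.[_] => Ka Kb; case/andP: tab => at_ tb.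
(* The alternative [u = 0] covers [t = a] and [t = b], where strict inequality is impossible. *)
have lt_sqr (e u v : R) : 1 < e -> 0 <= v -> e * u ^+ 2 <= v ^+ 2 ->
    `|u| < v \/ u = 0.
  move=> e1 v0 H; have [->|u0] := eqVneq u 0; [by right|left].
  rewrite -ltr_sqr ?nnegrE // real_normK ?num_real //; apply: lt_le_trans H.
  by rewrite ltr_pMl // lt_neqAle eq_sym sqrf_eq0 u0 sqr_ge0.
have := lt_sqr _ _ _ ea1 _ Ka; rewrite subr_ge0 => /(_ at_).
have := lt_sqr _ (b - y) (b - t) eb1; rewrite subr_ge0 -![(b - _) ^+ 2]sqrrN !opprB.
move=> /(_ tb Kb); rewrite !ltr_norml.
by move=> [/andP[? ?]|?] [/andP[? ?]|?]; lra.
Qed.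

(** Iterates are kept as polynomials so that their degree can serve as the exponent in
    [normc_horner_seg]. *)
Fixpoint iter_poly (S : nzRingType) (p : {poly S}) (n : nat) : {poly S} :=
  if n is m.+1 then p \Po iter_poly S p m else 'X.

Lemma horner_iter_poly (S : comNzRingType) (p : {poly S}) n z :
  (iter_poly S p n).[z] = iter n (fun w => p.[w]) z.
Proof. by elim: n => [|n IH] /=; rewrite ?hornerX // horner_comp IH. Qed.

Lemma size_iter_poly (S : idomainType) (p : {poly S}) n :
  (size (iter_poly S p n)).-1 = ((size p).-1 ^ n)%N.
Proof.
by elim: n => [|n IH] /=; rewrite ?size_polyX ?expn0 // size_comp_poly IH expnS.
Qed.

(** The degree of the n-th iterate exceeds [n], and Bernoulli's inequality turns the exponential
    gain into the linear factor [n.+1], which already tends to infinity. The factor 1/4 arises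
    because the real number f^n(s) is at least (b - a)/2 away from [a] or from [b]. *)
Lemma escape_bound (f : {poly R}) (a b : R) (z : C) (n : nat) :
  a < b -> (2 < size f)%N ->
  (forall w, (toC f).[w] = a%:C -> exists2 r, a <= r <= b & w = r%:C) ->
  (forall w, (toC f).[w] = b%:C -> exists2 r, a <= r <= b & w = r%:C) ->
  n.+1%:R * seg_dist a b z ^+ 2 / 4 <=
    (normc (iter n (fun w => (toC f).[w]) z) + (`|a| + `|b|)) ^+ 2.
Proof.
move=> ab sf Ha Hb; set F := fun w => _.
have far (u : R) : (b - a) / 2 <= u -> (b - a) ^+ 2 / 4 <= u ^+ 2.
  by move: ab; rewrite -subr_gt0; move: (b - a) => l {Ha Hb}; nra.
have sf1 := ltnW sf.
(* Backward invariance, iterated: every root of f^m - t lies in the segment. *)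
have Hiter m t w : a <= t <= b -> iter m F w = t%:C ->
    exists2 r, a <= r <= b & w = r%:C.
  elim: m t => [|m IH] t tab /=; first by exists t.
  by move=> /(preimage_seg _ _ _ _ _ ab sf1 tab Ha Hb)[r /IH]; exact.
set L2 := (b - a) ^+ 2; have L20 : 0 < L2 by rewrite exprn_gt0 ?subr_gt0.
set D2 := seg_dist a b z ^+ 2; have D20 : 0 <= D2 by exact: sqr_ge0.
have e0 : 0 <= D2 / L2 by rewrite divr_ge0 // ltW.
pose G := iter_poly C (toC f) n; pose x := clamp a b (complex.Re z).
have sG : ((size G).-1 > n)%N.
  by rewrite size_iter_poly size_map_poly ltn_expl // -ltnS prednK // ltnW.
have sG1 : (1 < size G)%N by rewrite -subn_gt0 subn1; exact: leq_ltn_trans sG.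
have Bern m : 1 + m%:R * (D2 / L2) <= (1 + D2 / L2) ^+ m.
  elim: m => [|m IH]; first by rewrite mul0r addr0.
  rewrite exprS; apply: le_trans (ler_wpM2l _ IH); last by rewrite addr_ge0.
  have := mulr_ge0 (mulr_ge0 (ler0n R m) e0) e0.
  by rewrite -natr1; move: (D2 / L2) (m%:R) => e k; nra.
have key t : a <= t <= b ->
    (n.+1%:R * (D2 / L2)) * normc ((iter n (fun u => f.[u]) x)%:C - t%:C) ^+ 2 <=
      normc (iter n F z - t%:C) ^+ 2.
  move=> tab; have := normc_horner_seg a b (G - t%:C%:P) z ab.
  have itE y : iter n F y%:C = (iter n (fun u => f.[u]) y)%:C.
    by elim: n {sG sG1 G Hiter} => //= m ->; rewrite /F horner_toC.
  rewrite !(hornerD, hornerN, hornerC) !horner_iter_poly -/F -/x itE size_subC // => H.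
  apply: le_trans (H _ _) => [||w].
  - rewrite ler_wpM2r ?sqr_ge0 //; apply: le_trans (Bern _).
    apply: ler_wpDl => //; rewrite ler_wpM2r // ler_nat //.
  - by rewrite -size_poly_eq0 size_subC // -lt0n ltnW.
  - by rewrite rootE !hornerE horner_iter_poly subr_eq0 => /eqP/Hiter; exact.
set y := iter n _ x in key.
(* Take for [t] the endpoint on the other side of the midpoint from [y]. *)
have [t tab yt] : exists2 t, a <= t <= b & (b - a) ^+ 2 / 4 <= normc (y%:C - t%:C) ^+ 2.
  have E t : normc (y%:C - t%:C) ^+ 2 = (y - t) ^+ 2.
    by rewrite -rmorphB normc_real real_normK ?num_real.
  have [?|?] := leP y ((a + b) / 2).
    exists b; first by rewrite lexx andbT ltW.
    by rewrite E -[X in _ <= X]sqrrN; apply: far; lra.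
  exists a; first by rewrite lexx ltW.
  by rewrite E; apply: far; lra.
have : n.+1%:R * D2 / 4 <= normc (iter n F z - t%:C) ^+ 2.
  apply: le_trans (key t tab); apply: le_trans (ler_wpM2l _ yt).
    by rewrite -/L2 le_eqVlt; apply/orP; left; apply/eqP; field; rewrite gt_eqF.
  by rewrite mulr_ge0 // ler0n.
move=> H; apply: le_trans H _; rewrite ler_sqr ?nnegrE ?normc_ge0 //.
  apply: le_trans (le_normcD _ _) _; rewrite lerD2l normcN normc_real.
  case/andP: tab => at_ tb; have := ler_norm a; have := ler_norm b.
  have := ler_norm (- a); have := normr_ge0 a; have := normr_ge0 b; rewrite normrN.
  by move=> *; rewrite ler_norml; lra.
by rewrite !addr_ge0 ?normc_ge0.
Qed.

(** * The extreme real fixed points *)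

Lemma seq_maximum (s : seq R) (x0 : R) : x0 \in s ->
  exists2 m, m \in s & forall x, x \in s -> x <= m.
Proof.
elim: s x0 => [//|y s IH] x0 _; case: s IH => [_|z s /(_ z)].
  by exists y => [|x]; rewrite inE // => /eqP ->.
case=> [|m ms mM]; first by rewrite mem_head.
have [ym|my] := leP y m.
  by exists m => [|x]; rewrite inE ?ms ?orbT // => /predU1P[->|/mM].
exists y; first by rewrite mem_head.
by move=> x; rewrite inE => /predU1P[->|/mM/le_trans] //; apply; exact: ltW.
Qed.

(** The polynomial f - X has odd degree and positive leading coefficient. It therefore has a real
    root, and beyond its extreme roots it keeps the sign it has at the corresponding infinity. *)
Lemma fix_real_extrema (d : nat) (f : {poly R}) :
  size f = d.+1 -> odd d -> (3 <= d)%N -> 0 < lead_coef f ->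
  exists a b, [/\ f.[a] = a, f.[b] = b, a <= b,
    forall x, b < x -> x < f.[x] & forall x, x < a -> f.[x] < x].
Proof.
move=> sf od d3 lf; pose q := f - 'X.
have sX : (size (- 'X : {poly R})%R < size f)%N.
  by rewrite size_polyN size_polyX sf ltnS ltnW.
have sq : size q = d.+1 by rewrite size_polyDl.
have lq : lead_coef q = lead_coef f by rewrite lead_coefDl.
have q0 : q != 0 by rewrite -size_poly_eq0 sq.
have qE x : q.[x] = f.[x] - x by rewrite !hornerE.
have rE x : (x \in rootsR q) = root q x by rewrite -roots_on_rootsR.
have rfix x : root q x -> f.[x] = x.
  by rewrite rootE qE subr_eq0 => /eqP.
have [x0 /[dup] qx0] : {x | root q x} by apply: odd_poly_root; rewrite sq /= od.
rewrite -rE => rx0.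
have [b rb bM] := seq_maximum _ _ rx0.
have [a ra aM] := seq_maximum (map -%R (rootsR q)) _ (map_f _ rx0).
have [a' ra' aE] := mapP ra; exists a', b; split.
- by apply: rfix; rewrite -rE.
- by apply: rfix; rewrite -rE.
- exact: bM.
- move=> x bx.
  have := @sgp_pinftyP R x q _ x; rewrite in_itv /= lexx /= => H.
  rewrite -subr_gt0 -qE -sgr_gt0 H // ?/sgp_pinfty ?lq ?gtr0_sg //.
  move=> y; rewrite in_itv /= andbT => xy; rewrite -rE; apply/negP => /bM.
  by rewrite leNgt (lt_le_trans bx).
- move=> x xa.
  have := @sgp_minftyP R x q _ x; rewrite in_itv /= lexx /= => H.
  rewrite -subr_lt0 -qE -sgr_lt0 H // ?/sgp_minfty ?sq ?lq /=.
    by rewrite -signr_odd od expr1 mulN1r sgrN gtr0_sg // oppr_lt0 ltr01.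
  move=> y; rewrite in_itv /= => yx; rewrite -rE; apply/negP => /(map_f -%R)/aM.
  by rewrite aE lerN2 leNgt (le_lt_trans yx).
Qed.

(* If there were a single fixed point [a], then [f] would be [a + c (X - a)^d],
   which lies below the diagonal just to the right of [a]. *)
Lemma fix_real_nontrivial (f : {poly R}) (a : R) :
  (2 < size f)%N -> f.[a] = a -> (forall x, a < x -> x < f.[x]) ->
  exists2 z, (toC f).[z] = a%:C & z <> a%:C.
Proof.
move=> sf fa fgt; apply: contrapT => H.
have Ha z : root (toC f - a%:C%:P) z -> z = a%:C.
  rewrite rootE !hornerE subr_eq0 => /eqP fz; apply: contrapT => za.
  by apply: H; exists z.
have sF : (2 < size (toC f - a%:C%:P)%R)%N.
  by rewrite size_subC size_map_poly // ltnW.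
have F0 : toC f - a%:C%:P != 0 by rewrite -size_poly_eq0 -lt0n (ltn_trans _ sF).
have [rs [srs /(_ F0) rrs pE]] := normc_horner_roots (toC f - a%:C%:P).
set c := normc _ in pE.
have fE h : 0 < h -> `|f.[a + h] - a| = c * h ^+ size rs.
  move=> h0; have := pE (a + h)%:C.
  rewrite !(hornerD, hornerN, hornerC) horner_toC -rmorphB normc_real => ->.
  congr (_ * _); elim: rs rrs {srs pE} => [|r rs IH] rrs; first by rewrite big_nil.
  rewrite big_cons exprS IH => [|s ss]; last by apply: rrs; rewrite inE ss orbT.
  congr (_ * _); rewrite (Ha r) ?rrs ?mem_head // -rmorphB normc_real.
  by rewrite addrAC subrr add0r gtr0_norm.
have c0 : 0 <= c by exact: normc_ge0.
(* This [h] satisfies h <= 1 and c h <= 1, hence c h^m <= c h^2 <= h for the degree m >= 2, so that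
   f(a + h) <= a + h. *)
pose h := (1 + c)^-1; have c1 : 0 < 1 + c by rewrite ltr_wpDr.
have h0 : 0 < h by rewrite invr_gt0.
have h1 : h <= 1 by rewrite invf_le1 // lerDl.
have := fgt (a + h); rewrite ltrDl h0 => /(_ isT) fh.
have : `|f.[a + h] - a| <= c * h ^+ 2.
  rewrite fE // ler_wpM2l // ler_wiXn2l ?(ltW h0) //.
  by rewrite srs -ltnS prednK // (ltn_trans _ sF).
have : c * h ^+ 2 <= h.
  rewrite expr2 mulrA ler_piMl ?(ltW h0) // /h ler_pdivrMr // mul1r.
  by rewrite lerDr.
have := ler_norm (f.[a + h] - a); lra.
Qed.

(** * Chordal against Euclidean distance, and neighbourhoods on the sphere *)

Lemma sqrt1D_ge1 (x : R) : 1 <= Num.sqrt (1 + x ^+ 2).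
Proof. by rewrite -sqrtr1 ler_wsqrtr // ?sqrtr1 lerDl sqr_ge0. Qed.

Lemma sqrt1D_le (x : R) : 0 <= x -> Num.sqrt (1 + x ^+ 2) <= 1 + x.
Proof.
move=> x0; rewrite -[leRHS]ger0_norm ?addr_ge0 // -sqrtr_sqr ler_wsqrtr //.
by rewrite sqrrD expr1n mul1r -addrA lerD2l lerDr mulrn_wge0.
Qed.

Lemma chordal_le (z w : C) : chordal (Some z) (Some w) <= 2 * normc (z - w).
Proof.
rewrite chordal_Some ler_pdivrMr; last first.
  by rewrite mulr_gt0 // (lt_le_trans ltr01) // sqrt1D_ge1.
rewrite ler_peMr ?mulr_ge0 ?normc_ge0 //.
by rewrite (le_trans (sqrt1D_ge1 (normc z))) // ler_peMr ?sqrtr_ge0 // sqrt1D_ge1.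
Qed.

Lemma chordal_infty_lt (e : R) (z : C) : 0 < e -> 2 / e <= normc z ->
  chordal (Some z) None < e.
Proof.
move=> e0; rewrite ler_pdivrMr // => ez.
rewrite chordal_infty ltr_pdivrMr; last first.
  by rewrite (lt_le_trans ltr01) // sqrt1D_ge1.
apply: le_lt_trans ez _; rewrite mulrC ltr_pM2l //.
rewrite -[ltLHS]ger0_norm ?normc_ge0 // -sqrtr_sqr ltr_sqrt ?ltrDr //.
by rewrite ltr_pwDl ?sqr_ge0.
Qed.

Lemma chordal_infty_gt (M : R) (z : C) : 0 <= M ->
  chordal (Some z) None < 2 / (1 + M) -> M < normc z.
Proof.
move=> M0; rewrite chordal_infty; apply: contraTT; rewrite -!leNgt => zM.
rewrite ler_pM2l // lef_pV2 ?posrE ?ltr_pwDl //.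
  by rewrite (le_trans (sqrt1D_le _ (normc_ge0 z))) // lerD2l.
by rewrite (lt_le_trans ltr01) // sqrt1D_ge1.
Qed.

(** Put c = 1 + |z| and u = |z - w|. Since 1 + |w| <= c + u, the chordal distance is at least 2u /
    (c (c + u)), which increases with u; the bound is its value at u = [e]. *)
Lemma chordal_Some_lt (e : R) (z w : C) : 0 < e ->
  chordal (Some z) (Some w) < 2 * e / ((1 + normc z) * (1 + normc z + e)) ->
  normc (z - w) < e.
Proof.
move=> e0; apply: contraTT; rewrite -!leNgt => ezw.
have [c cE] : exists c, c = 1 + normc z by exists (1 + normc z).
have c0 : 0 < c by rewrite cE ltr_pwDl ?normc_ge0.
rewrite -cE chordal_Some; set u : R := normc (z - w) in ezw *.
have u0 : 0 < u by exact: lt_le_trans ezw.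
apply: (@le_trans _ _ (2 * u / (c * (c + u)))).
  rewrite -subr_ge0; have -> : 2 * u / (c * (c + u)) - 2 * e / (c * (c + e)) =
      2 * (u - e) / ((c + u) * (c + e)).
    by field; rewrite (lt0r_neq0 (addr_gt0 c0 e0)) (lt0r_neq0 (addr_gt0 c0 u0)) lt0r_neq0.
  by rewrite divr_ge0 ?mulr_ge0 ?subr_ge0 ?addr_ge0 ?(ltW c0) ?(ltW e0) ?(ltW u0).
rewrite ler_pM2l ?mulr_gt0 // lef_pV2 ?posrE ?mulr_gt0 ?addr_gt0 //; last first.
- by rewrite (lt_le_trans ltr01) // sqrt1D_ge1.
- by rewrite (lt_le_trans ltr01) // sqrt1D_ge1.
rewrite ler_pM ?sqrtr_ge0 //; first by rewrite cE; exact: sqrt1D_le (normc_ge0 z).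
apply: le_trans (sqrt1D_le _ (normc_ge0 w)) _; rewrite cE -addrA lerD2l.
rewrite /u normc_distC -lerBlDl; exact: ler_normc_sub.
Qed.

Lemma nbhs_Some (z : C) (A : set (P1C R)) (e : R) : 0 < e ->
  (forall w, normc (z - w) < e -> A (Some w)) -> nbhs (Some z : P1C R) A.
Proof.
move=> e0 H; have [c cE] : exists c, c = 1 + normc z by exists (1 + normc z).
have c0 : 0 < c by rewrite cE ltr_pwDl ?normc_ge0.
apply/nbhs_ballP; exists (2 * e / (c * (c + e))) => /=.
  by rewrite divr_gt0 ?mulr_gt0 ?addr_gt0.
case=> [w|]; rewrite ball_chordalE /=; first by rewrite cE; move=> /(chordal_Some_lt _ _ _ e0)/H.
(* Infinity is outside the ball: its distance from [z] is at least 2 / c, and the radius is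
   smaller. *)
rewrite chordal_infty ltr_pdivrMr; last first.
  by rewrite (lt_le_trans ltr01) // sqrt1D_ge1.
move=> /lt_le_trans /(_ (ler_wpM2l _ (sqrt1D_le _ (normc_ge0 z)))).
rewrite -cE divr_ge0 ?mulr_ge0 ?addr_ge0 ?ltW // => /(_ isT).
have -> : 2 * e / (c * (c + e)) * c = 2 * (e / (c + e)).
  by field; rewrite !gt_eqF ?addr_gt0.
rewrite ltr_pMr // ltr_pdivlMr ?addr_gt0 // mul1r => ?; lra.
Qed.

Lemma nbhs_infty (A : set (P1C R)) (M : R) : A None ->
  (forall w, M < normc w -> A (Some w)) -> nbhs (None : P1C R) A.
Proof.
move=> A0 H; apply/nbhs_ballP; exists (2 / (1 + `|M|)) => /=.
  by rewrite divr_gt0 // ltr_pwDl.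
case=> [w|//]; rewrite ball_chordalE /= chordal_sym => /chordal_infty_gt.
by move=> /(_ (normr_ge0 M)) Mw; apply/H/(le_lt_trans _ Mw)/ler_norm.
Qed.

(** * Continuity of iterates, and escape to infinity *)

Lemma horner_continuousc (p : {poly C}) (z : C) (e : R) : 0 < e ->
  exists2 d, 0 < d & forall w, normc (z - w) < d -> normc (p.[z] - p.[w]) < e.
Proof.
elim/poly_ind: p e => [|p c IH] e e0.
  by exists 1 => // w _; rewrite !horner0 subrr normc0.
have [k kE] : exists k, k = 1 + normc z by exists (1 + normc z).
have k0 : 0 < k by rewrite kE ltr_pwDl ?normc_ge0.
have [m mE] : exists m, m = 1 + normc p.[z] by exists (1 + normc p.[z]).
have m0 : 0 < m by rewrite mE ltr_pwDl ?normc_ge0.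
have [|d d0 H] := IH (e / (2 * k)); first by rewrite divr_gt0 ?mulr_gt0.
(* The bound 1 keeps |w| <= k; the other two make each summand of the product rule at most e/2. *)
exists (Num.min d (Num.min 1 (e / (2 * m)))).
  by rewrite !lt_min d0 ltr01 divr_gt0 ?mulr_gt0.
move=> w; rewrite !lt_min => /and3P[/H zwd zw1 zwm].
rewrite !hornerMXaddC.
have -> : p.[z] * z + c - (p.[w] * w + c) = (p.[z] - p.[w]) * w + p.[z] * (z - w) by ring.
apply: le_lt_trans (le_normcD _ _) _; rewrite !normcM.
have wk : normc w <= k.
  by have := ler_normc_sub w z; rewrite normc_distC kE; lra.
have : normc (p.[z] - p.[w]) * normc w <= e / (2 * k) * k.
  by rewrite ler_pM ?normc_ge0 // ltW.
have : normc p.[z] * normc (z - w) < m * (e / (2 * m)).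
  apply: (@le_lt_trans _ _ (m * normc (z - w))); last by rewrite ltr_pM2l.
  by rewrite ler_wpM2r ?normc_ge0 // mE lerDr.
have -> : m * (e / (2 * m)) = e / 2 by field; rewrite gt_eqF.
have -> : e / (2 * k) * k = e / 2 by field; rewrite gt_eqF.
by move=> ? ?; lra.
Qed.

Lemma iter_P1map (p : {poly C}) n (z : C) :
  iter n (P1map p) (Some z) = Some (iter n (fun w => p.[w]) z).
Proof. by elim: n => //= n ->. Qed.

Lemma iter_P1map_infty (p : {poly C}) n : iter n (P1map p) None = None.
Proof. by elim: n => //= n ->. Qed.

Lemma iter_continuousc (p : {poly C}) (z : C) (N : nat) (e : R) : 0 < e ->
  exists2 d, 0 < d & forall w, normc (z - w) < d -> forall n, (n < N)%N ->
    normc (iter n (fun w => p.[w]) z - iter n (fun w => p.[w]) w) < e.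
Proof.
move=> e0; elim: N => [|N [d d0 IH]]; first by exists 1.
have [d' d'0 H] := horner_continuousc (iter_poly C p N) z e e0.
exists (Num.min d d'); first by rewrite lt_min d0.
move=> w; rewrite lt_min => /andP[/IH wd /H wd'] n.
rewrite ltnS leq_eqVlt => /predU1P[->|/wd //].
by rewrite -!horner_iter_poly.
Qed.

Lemma escape_radius (p : {poly C}) : (2 < size p)%N ->
  exists2 M, 0 <= M & forall z, M < normc z -> 2 * normc z <= normc p.[z].
Proof.
move=> sp; have [rs [srs _ pE]] := normc_horner_roots p.
set c := normc _ in pE; pose m := \sum_(r <- rs) normc r.
have c0 : 0 < c.
  rewrite lt_neqAle eq_sym normc_ge0 andbT; apply: contraTneq sp => /eq0_normc/eqP.
  by rewrite lead_coef_eq0 => /eqP ->; rewrite size_poly0.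
have m0 : 0 <= m by apply: sumr_ge0 => r _; exact: normc_ge0.
have k0 : 0 <= 2 * (1 + m) / c by rewrite divr_ge0 ?mulr_ge0 ?addr_ge0 // ltW.
(* With u = |z| - m, this radius ensures u >= 1 and c u >= 2 (1 + m). Each factor |z - r| is at
   least u and the degree is at least 2, so |p(z)| >= c u^2 >= 2 (1 + m) u >= 2 (u + m) = 2 |z|. *)
exists (m + (1 + 2 * (1 + m) / c)); first by rewrite !addr_ge0.
move=> z Mz; pose u := normc z - m.
have u1 : 1 <= u by rewrite /u; lra.
have cu : 2 * (1 + m) <= c * u.
  by rewrite [c * u]mulrC -ler_pdivrMr // /u; lra.
have prod_ge : u ^+ size rs <= \prod_(r <- rs) normc (z - r).
  have : forall r, r \in rs -> u <= normc (z - r).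
    move=> r rrs; apply: le_trans (ler_normc_sub _ _); rewrite lerD2l lerN2.
    rewrite /m (big_rem r) //= lerDl; apply: sumr_ge0 => *; exact: normc_ge0.
  have u0 : 0 <= u by lra.
  elim: (rs) => [|r s IH] H; first by rewrite big_nil.
  rewrite big_cons exprS ler_pM ?exprn_ge0 //; first by rewrite H ?mem_head.
  by apply: IH => t ts; rewrite H // inE ts orbT.
rewrite pE; apply: (@le_trans _ _ (c * u ^+ 2)); last first.
  rewrite ler_pM2l //; apply: le_trans prod_ge; rewrite ler_weXn2l //.
  by rewrite srs -ltnS prednK // (ltn_trans _ sp).
have -> : normc z = u + m by rewrite /u; lra.
have u0 : 0 <= u by lra.
rewrite expr2 mulrA; apply: (@le_trans _ _ (2 * (1 + m) * u)).
  by have : 0 <= m * (u - 1) by [rewrite mulr_ge0 ?subr_ge0]; lra.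
exact: ler_wpM2r.
Qed.

(** Once outside the disc of radius [M], an orbit at least doubles its modulus at every step; the
    weaker linear growth is enough for the Archimedean property. *)
Lemma escape_growth (p : {poly C}) (M : R) (z : C) (B : R) : 0 <= M ->
  (forall z, M < normc z -> 2 * normc z <= normc p.[z]) ->
  (exists n, M < normc (iter n (fun w => p.[w]) z)) ->
  exists n, B <= normc (iter n (fun w => p.[w]) z).
Proof.
move=> M0 HM [n]; set u := normc _ => Mu.
have u0 : 0 < u by exact: le_lt_trans Mu.
have H k : k.+1%:R * u <= normc (iter (k + n) (fun w => p.[w]) z).
  elim: k => [|k IH]; first by rewrite mul1r.
  rewrite addSn iterS; apply: le_trans (HM _ _).
    by move: IH; have := ler0n R k; rewrite -!natr1; nra.
  apply: lt_le_trans Mu _; apply: le_trans IH.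
  by rewrite ler_peMl ?(ltW u0) // ler1n.
exists (Num.bound (`|B| / u) + n)%N; apply: le_trans (H _).
apply: le_trans (ler_norm B) _; rewrite -ler_pdivrMr //.
apply: ltW; apply: lt_trans (archi_boundP _) _; first by rewrite divr_ge0 // ltW.
by rewrite ltr_nat.
Qed.

(** Take equicontinuity with d = 1 / (1 + M). If one orbit comes within d of infinity, a
    neighbouring one is at that time within 2 d = 2 / (1 + M), which means modulus above [M]. *)
Lemma fatou_escape_locally_constant (p : {poly C}) (M : R) (z : C) : 0 <= M ->
  (forall z, M < normc z -> 2 * normc z <= normc p.[z]) ->
  fatou_set p (Some z) ->
  exists2 e, 0 < e & forall w, normc (z - w) < e ->
    (exists n, M < normc (iter n (fun w => p.[w]) z)) <->
    (exists n, M < normc (iter n (fun w => p.[w]) w)).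
Proof.
move=> M0 HM Fz; pose d := (1 + M)^-1.
have d0 : 0 < d by rewrite invr_gt0 ltr_pwDl.
have entE : entourage [set xy : P1C R * P1C R | ball xy.1 d xy.2].
  by rewrite -entourage_from_ballE; exists d.
have := proj1 (equicontinuous_iteratesP _ _) (@equicontinuous_fatou_set R p) _ Fz _ entE.
have nF : nbhs (Some z : P1C R) (fatou_set p).
  by apply: open_nbhs_nbhs; split=> //; exact: open_fatou_set.
move=> /(filterI nF) /nbhs_ballP[e /= e0 H].
exists (e / 2); first by rewrite divr_gt0.
move=> w zw; have [Fw /(_ Fw) {H}Hw] : (fatou_set p `&` (fun y => fatou_set p y ->
    forall n, ball (iter n (P1map p) (Some z)) d (iter n (P1map p) y))) (Some w).
  apply: H; rewrite ball_chordalE /=; apply: le_lt_trans (chordal_le _ _) _; lra.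
have escape x y : (forall n, chordal (iter n (P1map p) (Some x))
      (iter n (P1map p) (Some y)) < d) ->
    (exists n, M < normc (iter n (fun w => p.[w]) x)) ->
    exists n, M < normc (iter n (fun w => p.[w]) y).
  move=> xy /(escape_growth _ _ _ (2 / d) M0 HM)[n /(chordal_infty_lt _ _ d0) xn].
  exists n; apply: chordal_infty_gt => //.
  have := xy n; rewrite !iter_P1map chordal_sym => yx.
  apply: le_lt_trans (chordal_triangle (Some (iter n (fun w => p.[w]) x)) _ _) _.
  by rewrite -/d; lra.
split; apply: escape => n; last rewrite chordal_sym; exact: Hw.
Qed.

(** * A real Julia set forces fixed points into the critical interval *)

Lemma fix_real_critical (f : {poly R}) : (2 < size f)%N ->
  julia_set (toC f) `<=` real_line R -> fix_real f `<=` critical_interval f.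
Proof.
move=> sf Jr x fx; apply/(critical_intervalP _ _ (ltnW sf)) => z0 z0x.
apply: contrapT => /eqP y0.
have [|M M0 HM] := escape_radius (toC f); first by rewrite size_map_poly.
pose esc z := exists n, M < normc (iter n (fun w => (toC f).[w]) z).
have fxC : (toC f).[x%:C] = x%:C by rewrite horner_toC fx.
(* Otherwise 2|x| <= |f(x)| = |x| with |x| > M >= 0. *)
have Mx : ~ M < normc x%:C.
  by move=> /[dup] Mx /HM; rewrite fxC; lra.
have nesc : ~ esc z0.
  case=> -[|n].
    by rewrite /= => /[dup] Mz /HM; rewrite z0x => Hx; apply: Mx; lra.
  rewrite iterSr z0x; suff -> : iter n (fun w => (toC f).[w]) x%:C = x%:C by [].
  by elim: n => //= n ->.
set y := complex.Im z0 in y0; pose ray t : C := complex.Re z0 +i* (t * y).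
have ray1 : ray 1 = z0 by rewrite /ray mul1r /y; case: (z0).
have ny0 : 0 < `|y| by rewrite normr_gt0.
have ray_dist s t : normc (ray s - ray t) = `|s - t| * `|y|.
  by rewrite /normc /= subrr expr0n add0r sqrtr_sqr -mulrBl normrM.
(* The contradiction comes at the supremum of [A]. The set contains 1 because [ray 1] is [z0], and
   it is bounded because |ray t| >= t |y| makes far points escape at time 0. *)
pose A := [set t : R | 1 <= t /\ ~ esc (ray t)].
have A1 : A 1 by rewrite /A /= ray1.
have Abound : ubound A (M / `|y|).
  move=> t [t1 tesc]; rewrite ler_pdivlMr // leNgt; apply/negP => Mt; apply: tesc.
  exists 0%N; apply: lt_le_trans Mt _; rewrite [iter _ _ _]/(ray t).
  rewrite -ler_sqr ?nnegrE ?normc_ge0 ?mulr_ge0 // ?(le_trans ler01) //.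
  by rewrite normc_sqr /= exprMn real_normK ?num_real // -exprMn lerDr sqr_ge0.
have supA : has_sup A by split; [exists 1 | exists (M / `|y|)].
have s1 : 1 <= sup A by apply: sup_upper_bound.
have Fs : fatou_set (toC f) (Some (ray (sup A))).
  apply: contrapT => /Jr[r _ []] _ /esym/eqP; rewrite mulf_eq0 (negPf y0) orbF.
  by rewrite gt_eqF // (lt_le_trans ltr01).
have [e e0 He] := fatou_escape_locally_constant _ _ _ M0 HM Fs.
have near_sup t : `|sup A - t| < e / `|y| -> esc (ray (sup A)) <-> esc (ray t).
  by rewrite ltr_pdivlMr // -ray_dist; exact: He.
have e'0 : 0 < e / `|y| by rewrite divr_gt0.
(* If the point at the supremum escapes, so does a nearby element of [A]; if not, neither does a
   point slightly beyond it. *)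
have [escs|nescs] := pselect (esc (ray (sup A))).
  have [t [t1 tesc] st] := sup_adherent e'0 supA.
  apply/tesc/near_sup => //; rewrite ger0_norm ?subr_ge0; first lra.
  by apply: sup_upper_bound.
have : A (sup A + e / `|y| / 2).
  split; first by lra.
  by apply/near_sup => //; rewrite opprD addNKr normrN gtr0_norm; lra.
move=> /(sup_upper_bound supA); lra.
Qed.

(** * Fixed points in the critical interval force a real Julia set *)

Lemma equicontinuous_off_segment (f : {poly R}) (a b : R) :
  a < b -> (2 < size f)%N ->
  (forall w, (toC f).[w] = a%:C -> exists2 r, a <= r <= b & w = r%:C) ->
  (forall w, (toC f).[w] = b%:C -> exists2 r, a <= r <= b & w = r%:C) ->
  equicontinuous_iterates (toC f)
    [set x | if x is Some z then 0 < seg_dist a b z else True].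
Proof.
move=> ab sf Ha Hb; apply/equicontinuous_iteratesP => x Ux E.
rewrite -entourage_from_ballE => -[e /= e0 eE].
set F := fun w => (toC f).[w]; set T := `|a| + `|b|.
have T0 : 0 <= T by rewrite addr_ge0.
have escape (B : R) n w : 0 < B ->
    (2 / B + T) ^+ 2 <= n.+1%:R * seg_dist a b w ^+ 2 / 4 ->
    chordal (Some (iter n F w)) None < B.
  move=> B0 /le_trans /(_ (escape_bound _ _ _ w n ab sf Ha Hb)).
  have B20 : 0 <= 2 / B by rewrite divr_ge0 // ltW.
  rewrite ler_sqr ?nnegrE ?addr_ge0 ?normc_ge0 // lerD2r => H.
  exact: chordal_infty_lt.
case: x Ux => [z|] Uz; last first.
  (* Here the distance to the segment is at least 2 (2/e + T), so [escape_bound] suffices for all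
     [n], including 0. *)
  apply: (nbhs_infty _ (2 * (2 / e + T) + T)) => [_|w Mw _] n; apply: eE => /=.
    by rewrite !iter_P1map_infty; exact: ballxx.
  rewrite iter_P1map_infty iter_P1map ball_chordalE /= chordal_sym; apply: escape => //.
  have B20 : 0 <= 2 / e by rewrite divr_ge0 // ltW.
  have Dw : 2 * (2 / e + T) <= seg_dist a b w.
    by have := seg_dist_ge _ _ w (ltW ab); rewrite -/T; lra.
  have D0 : 0 <= 2 / e + T by rewrite addr_ge0.
  have : (2 / e + T) ^+ 2 <= seg_dist a b w ^+ 2 / 4.
    have : (2 * (2 / e + T)) ^+ 2 <= seg_dist a b w ^+ 2.
      by rewrite ler_sqr ?nnegrE ?mulr_ge0 ?seg_dist_ge0.
    by rewrite exprMn; lra.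
  move=> /le_trans; apply; rewrite -mulrA ler_peMl ?ler1n //.
  by rewrite divr_ge0 ?sqr_ge0.
set D := seg_dist a b z in Uz.
(* From time [N] on, every orbit starting at distance at least D/2 from the segment is within e/2 of
   infinity, so any two are within [e] of each other. *)
pose N := Num.bound ((2 / (e / 2) + T) ^+ 2 / ((D / 2) ^+ 2 / 4)).
have D40 : 0 < (D / 2) ^+ 2 / 4 by rewrite divr_gt0 // exprn_gt0 // divr_gt0.
have far n w : (N <= n)%N -> D / 2 <= seg_dist a b w ->
    chordal (Some (iter n F w)) None < e / 2.
  move=> Nn Dw; apply: escape; first by rewrite divr_gt0.
  apply: (@le_trans _ _ (n.+1%:R * ((D / 2) ^+ 2 / 4))); last first.
    rewrite -mulrA ler_wpM2l // ler_wpM2r // ler_sqr ?nnegrE ?seg_dist_ge0 //.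
    by rewrite ltW // divr_gt0.
  rewrite -ler_pdivrMr //; apply/ltW; apply: lt_le_trans (archi_boundP _) _.
    by rewrite divr_ge0 ?sqr_ge0 // ltW.
  by rewrite ler_nat -/N ltnW.
have e20 : 0 < e / 2 by rewrite divr_gt0.
(* The finitely many earlier iterates are handled by continuity; e/2 absorbs the factor 2 of
   [chordal_le]. *)
have [d d0 Hd] := iter_continuousc (toC f) z N (e / 2) e20.
apply: (nbhs_Some _ _ (Num.min d (D / 2))); first by rewrite lt_min d0 divr_gt0.
move=> w; rewrite lt_min => /andP[zwd zwD] _ n; apply: eE => /=.
rewrite !iter_P1map ball_chordalE /=.
have [nN|Nn] := ltnP n N.
  apply: le_lt_trans (chordal_le _ _) _; have := Hd w zwd n nN; rewrite -/F; lra.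
apply: le_lt_trans (chordal_triangle None _ _) _.
have zD : D / 2 <= D by rewrite /D; have := ltW Uz; lra.
have wD : D / 2 <= seg_dist a b w.
  by have := seg_dist_lip _ _ z w (ltW ab); rewrite -/D; lra.
have := far n z Nn zD; have := far n w Nn wD; rewrite [chordal None _]chordal_sym; lra.
Qed.

Lemma open_off_segment (a b : R) : a <= b ->
  open ([set x | if x is Some z then 0 < seg_dist a b z else True] : set (P1C R)).
Proof.
move=> ab; rewrite openE => -[z|] /= Uz.
  apply: (nbhs_Some _ _ _ Uz) => w zw /=.
  by have := seg_dist_lip _ _ z w ab; lra.
apply: (nbhs_infty _ (`|a| + `|b|)) => //= w Mw.
by have := seg_dist_ge _ _ w ab; lra.
Qed.

Lemma critical_fix_real (d : nat) (f : {poly R}) :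
  size f = d.+1 -> odd d -> (3 <= d)%N -> 0 < lead_coef f ->
  fix_real f `<=` critical_interval f -> julia_set (toC f) `<=` real_line R.
Proof.
move=> sf od d3 lf fixI.
have sf2 : (2 < size f)%N by rewrite sf ltnS ltnW.
have [a [b [fa fb ab fgt flt]]] := fix_real_extrema d f sf od d3 lf.
(* Solutions of f = c are real by hypothesis, and they lie in [a, b] because f(r) > r for r > b and
   f(r) < r for r < a. *)
have seg c : f.[c] = c -> a <= c <= b -> forall w, (toC f).[w] = c%:C ->
    exists2 r, a <= r <= b & w = r%:C.
  move=> /fixI/(critical_intervalP _ _ (ltnW sf2)) H /andP[ac cb] w /[dup] /H wr.
  rewrite (real_complexP w wr) horner_toC => /real_complex_inj fr.
  exists (complex.Re w) => //; apply/andP; split; rewrite leNgt; apply/negP.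
    by move=> /[dup] ? /flt; rewrite fr; lra.
  by move=> /[dup] ? /fgt; rewrite fr; lra.
have Ha := seg a fa; have Hb := seg b fb; rewrite !lexx ab /= in Ha Hb.
(* Were [a = b], all solutions of f = a would equal [a], contrary to [fix_real_nontrivial]. *)
have {}ab : a < b.
  rewrite lt_neqAle ab andbT; apply/eqP => abE.
  have [|z za] := fix_real_nontrivial f a sf2 fa; first by rewrite abE.
  apply; have [r] := Ha isT z za; rewrite -abE -eq_le => /eqP <-.
  by [].
move=> x Jx; apply: contrapT => xR; apply: Jx.
apply: (@fatou_set_max R _ _ (open_off_segment _ _ (ltW ab))
  (equicontinuous_off_segment _ _ _ ab sf2 (Ha isT) (Hb isT))).
case: x xR => //= z zR; rewrite lt_neqAle eq_sym seg_dist_ge0 andbT.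
by apply/eqP => /(seg_dist_eq0 _ _ _ (ltW ab))[r _ zr]; apply: zR; exists r; rewrite ?zr.
Qed.

End JuliaSet.

Theorem proposition1p1 (R : realType) (d : nat) (f : {poly R})
    (size_f : size f = d.+1) (odd_d : odd d) (d_ge3 : (3 <= d)%N)
    (lead_f : 0 < lead_coef f) :
  julia_set (map_poly (real_complex R) f) `<=` real_line R
  <-> fix_real f `<=` critical_interval f.
Proof.
split; last exact: critical_fix_real size_f odd_d d_ge3 lead_f.
by apply: fix_real_critical; rewrite size_f ltnS ltnW.
Qed.
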